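(* Let $\sqrt{1+z+z^2} = \sum_{k=0}^\infty b_k z^k$ be the Taylor expansion at $0$, in the open unit disk, of the branch of the square root that equals $1$ at $z=0$. Then for every integer $n\ge 0$ the partial sum $\sum_{k=0}^n b_k z^k$ has no zeros in the closed unit disk $\overline{\mathbb D}=\{z\in\mathbb C : |z|\le 1\}$. *)

(* Defs.v *)
From Stdlib Require Import Reals.
From Coquelicot Require Import Coquelicot.

Open Scope C_scope.

Definition holomorphic_on_unit_disk (f : C -> C) : Prop :=
  forall z : C, (Cmod z < 1)%R -> ex_derive (K := C_AbsRing) (V := C_NormedModule) f z.

(* The zeros of 1 + z + z^2 lie on the unit circle, so on the open unit disk
   there is exactly one such f; its values outside the disk are irrelevant. *)
Definition is_sqrt_branch (f : C -> C) : Prop :=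
  holomorphic_on_unit_disk f /\
  (forall z : C, (Cmod z < 1)%R -> f z ^ 2 = 1 + z + z ^ 2) /\
  f 0 = 1.

(* Coefficients of a power series converging to f near 0 are unique, so b is
   the sequence of Taylor coefficients of f at 0. *)
Definition is_taylor_expansion_on_unit_disk (f : C -> C) (b : nat -> C) : Prop :=
  forall z : C, (Cmod z < 1)%R ->
    is_series (K := C_AbsRing) (V := C_NormedModule) (fun k : nat => b k * z ^ k) (f z).

(* [sum_n a n] is a 0 + ... + a n, with both end points included. *)
Definition partial_sum (b : nat -> C) (n : nat) (z : C) : C :=
  sum_n (G := C_AbelianMonoid) (fun k : nat => b k * z ^ k) n.

(* Main.v *)
(* Let A(z) = sqrt (1 - z), with A(0) = 1, and let s_n be the partial sums of
   f(z) = sqrt (1 + z + z^2), so that f(z) A(z) = sqrt (1 - z^3). The power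
   series sum_k h_k z^k of s_n A converges absolutely on the closed disk, and
   h_0 = 1 while h_k <= 0 for k >= 1. Its sum at 1 is nonnegative, because
   s_n(1) > 0. If s_n(z) = 0 with |z| <= 1, then the terms of
   sum_k h_k (1 - Re z^k) are nonpositive and have a nonnegative sum, so they
   vanish; as h_k < 0 for k > 2n, two consecutive powers of z equal 1, hence
   z = 1, a contradiction.

   For k <= n, h_k is a coefficient of sqrt (1 - z^3), hence nonpositive. For
   k > n, h_k = sum_(j <= n) u_j alpha_(k-j), where u and alpha are the
   coefficients of f and A. The signs of u_j for j >= 1 have period 3, namely
   +, +, -, so it is enough to bound h_k for n = 3m. As m grows with k fixed,
   that sum decreases until about m = k / 6 and then increases, so it is at
   most the larger of its first value alpha_k and its last value, which
   the identity f(z) A(z) = sqrt (1 - z^3) evaluates. *)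

Require Import Defs.
From Stdlib Require Import Reals Lra Lia.
From Coquelicot Require Import Coquelicot.

Open Scope R_scope.

(** * The coefficients of the two square roots *)

(* Taylor coefficients of [sqrt (1 - z)]. *)
Fixpoint alpha (k : nat) : R :=
  match k with
  | O => 1
  | S l => alpha l * (2 * INR l - 1) / (2 * INR l + 2)
  end.

Lemma alpha_S (l : nat) :
  (2 * INR l + 2) * alpha (S l) = (2 * INR l - 1) * alpha l.
Proof. pose proof (pos_INR l). simpl. field. lra. Qed.

Lemma alpha_neg (l : nat) : alpha (S l) < 0.
Proof.
induction l as [|l IH]; [simpl; lra|].
pose proof (alpha_S (S l)) as H.
pose proof (pos_INR l). rewrite S_INR in H. nra.
Qed.

(** These partial sums are the coefficients of sqrt (1 - z) / (1 - z) = (1 - z)^(-1/2), which is -2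
    times the derivative of sqrt (1 - z). *)
Lemma sum_alpha (n : nat) :
  sum_n alpha n = - (2 * INR n + 2) * alpha (S n).
Proof.
induction n as [|n IH].
- rewrite sum_O. simpl. field.
- rewrite sum_Sn, IH. pose proof (alpha_S (S n)) as H.
  rewrite S_INR in *. change plus with Rplus. lra.
Qed.

(* The recurrence is the coefficient form of
   [(1 + x + x^2) f' = (1 / 2 + x) f] for [f = sqrt (1 + x + x^2)]. *)
Definition root_coeff (u : nat -> R) : Prop :=
  u 0%nat = 1 /\ u 1%nat = 1 / 2 /\
  forall n : nat, (INR n + 2) * u (S (S n)) =
    - (INR n + 1 / 2) * u (S n) - (INR n - 1) * u n.

Lemma root_coeff_3 (u : nat -> R) (m : nat) : root_coeff u ->
  (3 * INR m + 3) * - u (3 * m + 3)%nat =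
  (3 * INR m + 3 / 2) * u (3 * m + 2)%nat + 3 * INR m * u (3 * m + 1)%nat.
Proof.
intros (_ & _ & H). specialize (H (3 * m + 1)%nat).
replace (S (S (3 * m + 1))) with (3 * m + 3)%nat in H by lia.
replace (S (3 * m + 1)) with (3 * m + 2)%nat in H by lia.
rewrite plus_INR, mult_INR in H. simpl INR in H. lra.
Qed.

(** Eliminating the negative coefficient [u (3 * m + 3)] through [root_coeff_3] leaves a recurrence
    from the pair at [3 * m + 1], [3 * m + 2] to the next such pair. This lemma and the next are its
    two halves, with denominators cleared. *)
Lemma root_coeff_4 (u : nat -> R) (m : nat) : root_coeff u ->
  (3 * INR m + 3) * (3 * INR m + 4) * u (3 * m + 4)%nat =
  3 * INR m * (3 * INR m + 5 / 2) * u (3 * m + 1)%nat +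
  3 / 4 * u (3 * m + 2)%nat.
Proof.
intros Hu. pose proof (root_coeff_3 u m Hu) as H3.
destruct Hu as (_ & _ & H). specialize (H (3 * m + 2)%nat).
replace (S (S (3 * m + 2))) with (3 * m + 4)%nat in H by lia.
replace (S (3 * m + 2)) with (3 * m + 3)%nat in H by lia.
rewrite plus_INR, mult_INR in H. simpl INR in H.
set (x := INR m) in *. clearbody x.
replace ((3 * x + 3) * (3 * x + 4) * u (3 * m + 4)%nat)
  with ((3 * x + 3) * (((1 + 1 + 1) * x + (1 + 1) + 2) * u (3 * m + 4)%nat)) by ring.
rewrite H.
replace ((3 * x + 3) * (- ((1 + 1 + 1) * x + (1 + 1) + 1 / 2) * u (3 * m + 3)%nat - ((1 + 1 + 1) * x + (1 + 1) - 1) * u (3 * m + 2)%nat))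
  with ((3 * x + 5 / 2) * ((3 * x + 3) * - u (3 * m + 3)%nat) - (3 * x + 3) * (3 * x + 1) * u (3 * m + 2)%nat) by field.
rewrite H3. field.
Qed.

Lemma root_coeff_5 (u : nat -> R) (m : nat) : root_coeff u ->
  (3 * INR m + 3) * (3 * INR m + 4) * (3 * INR m + 5) * u (3 * m + 5)%nat =
  (3 * INR m + 5 / 2) * ((3 * INR m) ^ 2 + 5 * (3 * INR m) + 15 / 4) * u (3 * m + 2)%nat
  - 3 / 4 * (3 * INR m) * u (3 * m + 1)%nat.
Proof.
intros Hu. pose proof (root_coeff_3 u m Hu) as H3.
pose proof (root_coeff_4 u m Hu) as H4.
destruct Hu as (_ & _ & H). specialize (H (3 * m + 3)%nat).
replace (S (S (3 * m + 3))) with (3 * m + 5)%nat in H by lia.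
replace (S (3 * m + 3)) with (3 * m + 4)%nat in H by lia.
rewrite plus_INR, mult_INR in H. simpl INR in H.
set (x := INR m) in *. clearbody x.
transitivity ((3 * x + 4) * (3 * x + 2) * ((3 * x + 3) * - u (3 * m + 3)%nat)
  - (3 * x + 7 / 2) * ((3 * x + 3) * (3 * x + 4) * u (3 * m + 4)%nat)).
- replace ((3 * x + 3) * (3 * x + 4) * (3 * x + 5) * u (3 * m + 5)%nat)
    with ((3 * x + 3) * (3 * x + 4) * (((1 + 1 + 1) * x + (1 + 1 + 1) + 2) * u (3 * m + 5)%nat)) by ring.
  rewrite H. field.
- rewrite H3, H4. field.
Qed.

Lemma root_coeff_2 (u : nat -> R) : root_coeff u -> u 2%nat = 3 / 8.
Proof. intros (H0 & H1 & H). specialize (H 0%nat). simpl in H. rewrite H0, H1 in H. lra. Qed.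

(** The third inequality is carried through the induction because it absorbs the negative term of
    [root_coeff_5]. It also settles the borderline cases of [partial_conv_incr] and
    [partial_conv_last]. *)
Lemma root_coeff_pos (u : nat -> R) (m : nat) : root_coeff u ->
  0 < u (3 * m + 1)%nat /\ 0 < u (3 * m + 2)%nat /\
  u (3 * m + 1)%nat <= 2 * u (3 * m + 2)%nat.
Proof.
intros Hu. induction m as [|m (Hp & Hq & Hpq)].
- simpl. rewrite (root_coeff_2 u Hu). destruct Hu as (_ & H1 & _). rewrite H1. lra.
- pose proof (root_coeff_4 u m Hu) as H4. pose proof (root_coeff_5 u m Hu) as H5.
  replace (3 * S m + 1)%nat with (3 * m + 4)%nat by lia.
  replace (3 * S m + 2)%nat with (3 * m + 5)%nat by lia.
  pose proof (pos_INR m) as Hx. set (x := 3 * INR m) in *.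
  assert (0 <= x) by (unfold x; lra). clearbody x.
  set (p := u (3 * m + 1)%nat) in *. set (q := u (3 * m + 2)%nat) in *.
  set (p' := u (3 * m + 4)%nat) in *. set (q' := u (3 * m + 5)%nat) in *.
  clearbody p q p' q'.
  assert (Hxp : x * p <= x * (2 * q)) by nra.
  assert (Hd : 0 < (x + 3) * (x + 4)) by nra.
  assert (Hx2 : 0 <= x * x) by nra.
  assert (Hxq : 0 <= x * q) by nra.
  assert (Hxxq : 0 <= x * x * q) by nra.
  assert (Hxxxq : 0 <= x * x * x * q) by nra.
  assert (Hxxp : x * x * p <= x * x * (2 * q)) by nra.
  assert (0 <= x * p) by nra.
  assert (0 <= x * x * p) by nra.
  split; [|split].
  + apply (Rmult_lt_reg_l ((x + 3) * (x + 4))); nra.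
  + apply (Rmult_lt_reg_l ((x + 3) * (x + 4) * (x + 5))); nra.
  + apply (Rmult_le_reg_l ((x + 3) * (x + 4) * (x + 5))); [nra|].
    replace ((x + 3) * (x + 4) * (x + 5) * p') with ((x + 5) * ((x + 3) * (x + 4) * p')) by ring.
    replace ((x + 3) * (x + 4) * (x + 5) * (2 * q')) with (2 * ((x + 3) * (x + 4) * (x + 5) * q')) by ring.
    rewrite H4, H5.
    assert (x * x * x * p <= x * x * x * (2 * q)) by (apply Rmult_le_compat_l; nra).
    lra.
Qed.

(** The constants serve [root_coeff_alpha_le], where 3/2 * 1/2 + 9/8 * 1/5 = 39/40 < 1. The bounds
    start at index 4 because [u 1] = 1/2 exceeds [- alpha 1 / 5] = 1/10. *)
Lemma root_coeff_le_alpha (u : nat -> R) (m : nat) : root_coeff u ->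
  u (3 * m + 4)%nat <= - alpha (m + 2) / 5 /\
  u (3 * m + 5)%nat <= - alpha (m + 2) / 2.
Proof.
intros Hu. induction m as [|m (Hp & Hq)].
- pose proof (root_coeff_4 u 0 Hu) as H4. pose proof (root_coeff_5 u 0 Hu) as H5.
  simpl in *. rewrite (root_coeff_2 u Hu) in *. destruct Hu as (_ & H1 & _). rewrite H1 in *. lra.
- pose proof (root_coeff_pos u (S m) Hu) as (Pp & Pq & _).
  pose proof (root_coeff_4 u (S m) Hu) as H4. pose proof (root_coeff_5 u (S m) Hu) as H5.
  pose proof (alpha_S (m + 2)) as Ha.
  pose proof (alpha_neg (m + 1)) as Hn. replace (S (m + 1)) with (m + 2)%nat in Hn by lia.
  replace (S m + 2)%nat with (S (m + 2)) by lia.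
  rewrite S_INR in H4, H5. rewrite plus_INR in Ha. simpl (INR 2) in Ha.
  replace (3 * S m + 1)%nat with (3 * m + 4)%nat in * by lia.
  replace (3 * S m + 2)%nat with (3 * m + 5)%nat in * by lia.
  pose proof (pos_INR m) as Hm. set (x := 3 * (INR m + 1)) in *.
  assert (Hx : 3 <= x) by (unfold x; lra).
  replace (INR m) with (x / 3 - 1) in Ha by (unfold x; field). clearbody x.
  set (p := u (3 * m + 4)%nat) in *. set (q := u (3 * m + 5)%nat) in *.
  set (p' := u (3 * S m + 4)%nat) in *. set (q' := u (3 * S m + 5)%nat) in *.
  set (a := - alpha (m + 2)) in *. replace (alpha (m + 2)) with (- a) in * by (unfold a; ring).
  set (a' := - alpha (S (m + 2))) in *. replace (alpha (S (m + 2))) with (- a') in * by (unfold a'; ring).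
  clearbody a a' p q p' q'.
  assert (Ha' : (x + 6) * a' = (x + 3 / 2) * a) by lra. clear Ha.
  assert (0 < a) by lra.
  split.
  + apply (Rmult_le_reg_l ((x + 6) * ((x + 3) * (x + 4)))); [nra|].
    replace ((x + 6) * ((x + 3) * (x + 4)) * p') with ((x + 6) * ((x + 3) * (x + 4) * p')) by ring.
    replace ((x + 6) * ((x + 3) * (x + 4)) * (a' / 5)) with ((x + 3) * (x + 4) / 5 * ((x + 6) * a')) by field.
    rewrite H4, Ha'.
    assert (x * (x + 5 / 2) * p <= x * (x + 5 / 2) * (a / 5)) by (apply Rmult_le_compat_l; nra).
    apply Rle_trans with ((x + 6) * (x * (x + 5 / 2) * (a / 5) + 3 / 4 * (a / 2))).
    * apply Rmult_le_compat_l; lra.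
    * assert (3 * a <= x * a) by (apply Rmult_le_compat_r; lra). lra.
  + apply (Rmult_le_reg_l ((x + 6) * ((x + 3) * (x + 4) * (x + 5)))); [apply Rmult_lt_0_compat; nra|].
    replace ((x + 6) * ((x + 3) * (x + 4) * (x + 5)) * q') with ((x + 6) * ((x + 3) * (x + 4) * (x + 5) * q')) by ring.
    replace ((x + 6) * ((x + 3) * (x + 4) * (x + 5)) * (a' / 2)) with ((x + 3) * (x + 4) * (x + 5) / 2 * ((x + 6) * a')) by field.
    rewrite H5, Ha'.
    (* The term of [H5] in [p] is negative and is dropped; [q] is replaced by its bound [a / 2]. *)
    apply Rle_trans with ((x + 6) * ((x + 5 / 2) * (x ^ 2 + 5 * x + 15 / 4) * (a / 2))).
    * apply Rmult_le_compat_l; [lra|].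
      assert ((x + 5 / 2) * (x ^ 2 + 5 * x + 15 / 4) * q <= (x + 5 / 2) * (x ^ 2 + 5 * x + 15 / 4) * (a / 2))
        by (apply Rmult_le_compat_l; [apply Rmult_le_pos; nra | lra]).
      nra.
    * assert (0 <= x * a) by nra. assert (0 <= x * x * a) by (apply Rmult_le_pos; nra). lra.
Qed.

(** The left side is the coefficient of z^(3m+3) in s_(3m) A: from the coefficient [alpha (S m)] of
    sqrt (1 - z^3), the terms j = 3m+1, 3m+2, 3m+3 have been removed, with [alpha 2] = -1/8,
    [alpha 1] = -1/2, [alpha 0] = 1. *)
Lemma root_coeff_alpha_le (u : nat -> R) (m : nat) : root_coeff u ->
  alpha (S m) - u (3 * m + 3)%nat + u (3 * m + 2)%nat / 2 + u (3 * m + 1)%nat / 8 <= 0.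
Proof.
intros Hu. pose proof (root_coeff_3 u m Hu) as H3.
pose proof (root_coeff_pos u m Hu) as (Pp & Pq & _).
destruct m as [|m].
- simpl in *. rewrite (root_coeff_2 u Hu) in *. destruct Hu as (_ & H1 & _). rewrite H1 in *. lra.
- pose proof (root_coeff_le_alpha u m Hu) as (Bp & Bq).
  pose proof (pos_INR (S m)) as Hm.
  replace (3 * m + 4)%nat with (3 * S m + 1)%nat in Bp by lia.
  replace (3 * m + 5)%nat with (3 * S m + 2)%nat in Bq by lia.
  replace (S (S m)) with (m + 2)%nat by lia.
  (* Both factors on the right of [root_coeff_3] are at most the factor on its left. *)
  assert (- u (3 * S m + 3)%nat <= u (3 * S m + 2)%nat + u (3 * S m + 1)%nat) by nra.
  lra.
Qed.

(** * Signs of the coefficients of the product *)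

(** For [n <= k] this is the coefficient of z^k in s_n A; for larger [n] the truncated [k - j] makes
    it meaningless. *)
Definition partial_conv (u : nat -> R) (k n : nat) : R :=
  sum_n (fun j => u j * alpha (k - j)) n.

Lemma partial_conv_S (u : nat -> R) (k n : nat) :
  partial_conv u k (S n) = partial_conv u k n + u (S n) * alpha (k - S n).
Proof. unfold partial_conv. now rewrite sum_Sn. Qed.

(* Three consecutive terms contribute a quantity whose sign is governed by that
   of [l - 3 m - 2]: both coefficients on the right change sign near there. *)
Lemma partial_conv_3 (u : nat -> R) (m l : nat) : root_coeff u ->
  4 * (INR l + 1) * (INR l + 2) * (3 * INR m + 3) *
    (partial_conv u (l + 3 * S m) (3 * S m) - partial_conv u (l + 3 * S m) (3 * m)) =
  alpha l *
    (u (3 * m + 1)%nat * (12 * INR l * (INR l - 3 * INR m) - 27 * INR m - 3) +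
     u (3 * m + 2)%nat * (6 * (INR l + 2) * (INR l - 3 * INR m - 2))).
Proof.
intros Hu. pose proof (root_coeff_3 u m Hu) as H3.
replace (3 * S m)%nat with (S (S (S (3 * m)))) by lia.
rewrite !partial_conv_S.
replace (l + S (S (S (3 * m))) - S (3 * m))%nat with (S (S l)) by lia.
replace (l + S (S (S (3 * m))) - S (S (3 * m)))%nat with (S l) by lia.
replace (l + S (S (S (3 * m))) - S (S (S (3 * m))))%nat with l by lia.
replace (S (3 * m)) with (3 * m + 1)%nat by lia.
replace (S (3 * m + 1)) with (3 * m + 2)%nat by lia.
replace (S (3 * m + 2)) with (3 * m + 3)%nat by lia.
pose proof (alpha_S l) as A1. pose proof (alpha_S (S l)) as A2. rewrite S_INR in A2.
set (x := INR m) in *. set (y := INR l) in *.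
set (p := u (3 * m + 1)%nat) in *. set (q := u (3 * m + 2)%nat) in *.
set (b := u (3 * m + 3)%nat) in *.
(* The grouping exhibits the left sides of [alpha_S] and [root_coeff_3], so that only [alpha l], [p]
   and [q] survive. *)
transitivity ((3 * x + 3) * (p * (2 * (y + 1) * ((2 * (y + 1) + 2) * alpha (S (S l))))
   + q * (2 * (y + 2) * ((2 * y + 2) * alpha (S l))))
   - 4 * (y + 1) * (y + 2) * alpha l * ((3 * x + 3) * - b)).
- ring.
- rewrite A1, A2, H3.
  replace (2 * (y + 1) * ((2 * (y + 1) - 1) * alpha (S l)))
    with ((2 * (y + 1) - 1) * ((2 * y + 2) * alpha (S l))) by ring.
  rewrite A1. field.
Qed.

(** With l = k - 3m - 3 the hypothesis reads l >= 3m + 2. Then both brackets in [partial_conv_3] are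
    nonnegative, while [alpha l] is negative. *)
Lemma partial_conv_decr (u : nat -> R) (m k : nat) : root_coeff u ->
  (6 * m + 6 <= k + 1)%nat ->
  partial_conv u k (3 * S m) <= partial_conv u k (3 * m).
Proof.
intros Hu Hk. pose proof (partial_conv_3 u m (k - 3 * S m) Hu) as H.
replace (k - 3 * S m + 3 * S m)%nat with k in H by lia.
assert (Hl : (3 * m + 2 <= k - 3 * S m)%nat) by lia.
set (l := (k - 3 * S m)%nat) in *. clearbody l.
pose proof (root_coeff_pos u m Hu) as (Pp & Pq & _).
assert (An : alpha l < 0) by (destruct l; [lia | apply alpha_neg]).
apply le_INR in Hl. rewrite plus_INR, mult_INR in Hl. simpl (INR 2) in Hl. simpl (INR 3) in Hl.
pose proof (pos_INR m). set (x := INR m) in *. set (y := INR l) in *.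
set (p := u (3 * m + 1)%nat) in *. set (q := u (3 * m + 2)%nat) in *.
assert (Cp : 0 <= 12 * y * (y - 3 * x) - 27 * x - 3) by nra.
assert (Cq : 0 <= 6 * (y + 2) * (y - 3 * x - 2)) by (apply Rmult_le_pos; lra).
assert (Hd : 0 < 4 * (y + 1) * (y + 2) * (3 * x + 3)) by (repeat apply Rmult_lt_0_compat; lra).
assert (0 <= p * (12 * y * (y - 3 * x) - 27 * x - 3) + q * (6 * (y + 2) * (y - 3 * x - 2)))
  by (apply Rplus_le_le_0_compat; apply Rmult_le_pos; lra).
nra.
Qed.

Lemma partial_conv_incr (u : nat -> R) (m k : nat) : root_coeff u ->
  (3 * m + 3 < k)%nat -> (k + 1 < 6 * m + 6)%nat ->
  partial_conv u k (3 * m) <= partial_conv u k (3 * S m).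
Proof.
intros Hu Hk1 Hk2. pose proof (partial_conv_3 u m (k - 3 * S m) Hu) as H.
replace (k - 3 * S m + 3 * S m)%nat with k in H by lia.
assert (Hl0 : (1 <= k - 3 * S m)%nat) by lia.
(* At l = 3m + 1 the first bracket is still positive, and the two together give 9 (m + 1) (p - 2 q)
   <= 0. For smaller l both brackets are nonpositive. *)
assert (Hl : (k - 3 * S m = 3 * m + 1 \/ k - 3 * S m <= 3 * m)%nat) by lia.
set (l := (k - 3 * S m)%nat) in *. clearbody l.
pose proof (root_coeff_pos u m Hu) as (Pp & Pq & Ppq).
assert (An : alpha l < 0) by (destruct l; [lia | apply alpha_neg]).
assert (Hl' : INR l = 3 * INR m + 1 \/ INR l <= 3 * INR m).
{ destruct Hl as [-> | Hl].
  - left. rewrite plus_INR, mult_INR. simpl. ring.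
  - right. apply le_INR in Hl. rewrite mult_INR in Hl. simpl (INR 3) in Hl. lra. }
apply le_INR in Hl0. simpl (INR 1) in Hl0. clear Hl.
pose proof (pos_INR m). set (x := INR m) in *. set (y := INR l) in *.
set (p := u (3 * m + 1)%nat) in *. set (q := u (3 * m + 2)%nat) in *.
assert (Hd : 0 < 4 * (y + 1) * (y + 2) * (3 * x + 3)) by (repeat apply Rmult_lt_0_compat; lra).
assert (p * (12 * y * (y - 3 * x) - 27 * x - 3) + q * (6 * (y + 2) * (y - 3 * x - 2)) <= 0).
{ destruct Hl' as [-> | Hl'].
  - replace (p * (12 * (3 * x + 1) * (3 * x + 1 - 3 * x) - 27 * x - 3) + q * (6 * (3 * x + 1 + 2) * (3 * x + 1 - 3 * x - 2)))
      with ((9 * x + 9) * (p - 2 * q)) by ring. nra.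
  - assert (12 * y * (y - 3 * x) - 27 * x - 3 <= 0) by nra.
    assert (6 * (y + 2) * (y - 3 * x - 2) <= 0) by nra. nra. }
nra.
Qed.

Lemma partial_conv_early (u : nat -> R) (m k : nat) : root_coeff u ->
  (6 * m <= k + 1)%nat -> partial_conv u k (3 * m) <= alpha k.
Proof.
intros Hu. induction m as [|m IH]; intros Hk.
- unfold partial_conv. rewrite sum_O, Nat.sub_0_r. destruct Hu as (-> & _). lra.
- eapply Rle_trans; [apply partial_conv_decr; [exact Hu | lia] | apply IH; lia].
Qed.

(* The recurrence is the coefficient form of [(1 - x^3) g' = - 3 / 2 x^2 g] for
   [g = sqrt (1 - x^3)]. *)
Lemma cubic_coeff (w : nat -> R) (m : nat) :
  w 0%nat = 1 -> w 1%nat = 0 -> w 2%nat = 0 ->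
  (forall k, (INR k + 3) * w (S (S (S k))) = (INR k - 3 / 2) * w k) ->
  w (3 * m)%nat = alpha m /\ w (3 * m + 1)%nat = 0 /\ w (3 * m + 2)%nat = 0.
Proof.
intros W0 W1 W2 Hw. induction m as [|m (I0 & I1 & I2)].
- simpl. auto.
- replace (3 * S m)%nat with (S (S (S (3 * m)))) by lia.
  replace (S (S (S (3 * m))) + 1)%nat with (S (S (S (3 * m + 1)))) by lia.
  replace (S (S (S (3 * m))) + 2)%nat with (S (S (S (3 * m + 2)))) by lia.
  pose proof (Hw (3 * m)%nat) as H0. pose proof (Hw (3 * m + 1)%nat) as H1.
  pose proof (Hw (3 * m + 2)%nat) as H2. rewrite I0 in H0. rewrite I1 in H1. rewrite I2 in H2.
  rewrite Rmult_0_r in H1, H2.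
  pose proof (pos_INR (3 * m)). pose proof (pos_INR (3 * m + 1)). pose proof (pos_INR (3 * m + 2)).
  pose proof (alpha_S m) as Ha.
  split; [|split].
  + rewrite mult_INR in *. simpl (INR 3) in *.
    apply (Rmult_eq_reg_l (2 * INR m + 2)); [|pose proof (pos_INR m); lra].
    rewrite Ha. lra.
  + apply Rmult_integral in H1. lra.
  + apply Rmult_integral in H2. lra.
Qed.

(* The product of [sum u_j x^j] with [sqrt (1 - x)] is [sqrt (1 - x^3)]. *)
Definition root_conv (u : nat -> R) : Prop :=
  forall m, partial_conv u (3 * m) (3 * m) = alpha m /\
    partial_conv u (3 * m + 1) (3 * m + 1) = 0 /\ partial_conv u (3 * m + 2) (3 * m + 2) = 0.

(** Removing the last one, two or three terms from the full convolution leaves -p, p/2 - q, or the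
    left side of [root_coeff_alpha_le], where p and q are [u] at 3m+1 and 3m+2. *)
Lemma partial_conv_last (u : nat -> R) (m k : nat) : root_coeff u -> root_conv u ->
  (3 * m < k <= 3 * m + 3)%nat -> partial_conv u k (3 * m) <= 0.
Proof.
intros Hu Hw Hk.
pose proof (root_coeff_pos u m Hu) as (Pp & Pq & Ppq).
assert (k = 3 * m + 1 \/ k = 3 * m + 2 \/ k = 3 * S m)%nat as [-> | [-> | ->]] by lia.
- destruct (Hw m) as (_ & H & _).
  replace (3 * m + 1)%nat with (S (3 * m)) in * by lia.
  rewrite partial_conv_S, Nat.sub_diag in H. change (alpha 0) with 1 in H. lra.
- destruct (Hw m) as (_ & _ & H).
  replace (3 * m + 2)%nat with (S (S (3 * m))) in * by lia.
  replace (3 * m + 1)%nat with (S (3 * m)) in * by lia.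
  rewrite !partial_conv_S, Nat.sub_diag in H.
  replace (S (S (3 * m)) - S (3 * m))%nat with 1%nat in H by lia.
  change (alpha 0) with 1 in H.
  replace (alpha 1) with (- (1 / 2)) in H by (simpl; field). lra.
- destruct (Hw (S m)) as (H & _ & _).
  pose proof (root_coeff_alpha_le u m Hu) as Hb.
  replace (3 * S m)%nat with (S (S (S (3 * m)))) in * by lia.
  rewrite !partial_conv_S, Nat.sub_diag in H.
  replace (S (S (S (3 * m))) - S (S (3 * m)))%nat with 1%nat in H by lia.
  replace (S (S (S (3 * m))) - S (3 * m))%nat with 2%nat in H by lia.
  replace (3 * m + 1)%nat with (S (3 * m)) in * by lia.
  replace (3 * m + 2)%nat with (S (S (3 * m))) in * by lia.
  replace (3 * m + 3)%nat with (S (S (S (3 * m)))) in * by lia.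
  change (alpha 0) with 1 in H.
  replace (alpha 1) with (- (1 / 2)) in H by (simpl; field).
  replace (alpha 2) with (- (1 / 8)) in H by (simpl; field). lra.
Qed.

(** In the increasing range the sum is pushed up by [d] blocks of three, to the last multiple of 3
    below [k], where [partial_conv_last] applies. *)
Lemma partial_conv_late (u : nat -> R) (d m k : nat) : root_coeff u -> root_conv u ->
  (3 * (m + d) < k <= 3 * (m + d) + 3)%nat -> (k + 1 < 6 * m + 6)%nat ->
  partial_conv u k (3 * m) <= 0.
Proof.
intros Hu Hw. revert m. induction d as [|d IH]; intros m Hk Hm.
- apply partial_conv_last; auto. lia.
- apply Rle_trans with (partial_conv u k (3 * S m)).
  + apply partial_conv_incr; auto; lia.
  + apply IH; lia.
Qed.

(** The one or two extra terms pair a positive [u] with a negative [alpha]. *)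
Lemma partial_conv_residue (u : nat -> R) (m r k : nat) : root_coeff u ->
  (r < 3)%nat -> (3 * m + r < k)%nat ->
  partial_conv u k (3 * m + r) <= partial_conv u k (3 * m).
Proof.
intros Hu Hr Hk. pose proof (root_coeff_pos u m Hu) as (Pp & Pq & _).
assert (Hneg : forall j, (j < k)%nat -> alpha (k - j) < 0).
{ intros j Hj. replace (k - j)%nat with (S (k - S j)) by lia. apply alpha_neg. }
assert (r = 0 \/ r = 1 \/ r = 2)%nat as [-> | [-> | ->]] by lia.
- rewrite Nat.add_0_r. lra.
- replace (3 * m + 1)%nat with (S (3 * m)) in * by lia. rewrite partial_conv_S.
  pose proof (Hneg (S (3 * m)) Hk). nra.
- replace (3 * m + 2)%nat with (S (S (3 * m))) in * by lia. rewrite !partial_conv_S.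
  replace (3 * m + 1)%nat with (S (3 * m)) in * by lia.
  pose proof (Hneg (S (3 * m)) ltac:(lia)). pose proof (Hneg (S (S (3 * m))) ltac:(lia)). nra.
Qed.

(** With n = 3m + r one has 6m <= 2n < k, so the whole range is decreasing and the strict bound
    [alpha k < 0] is available. *)
Lemma partial_conv_neg (u : nat -> R) (k n : nat) : root_coeff u ->
  (2 * n < k)%nat -> partial_conv u k n < 0.
Proof.
intros Hu Hk. pose proof (Nat.div_mod_eq n 3) as E.
pose proof (Nat.mod_upper_bound n 3 ltac:(lia)) as Hr.
set (m := (n / 3)%nat) in *. set (r := (n mod 3)%nat) in *. clearbody m r. subst n.
eapply Rle_lt_trans; [apply partial_conv_residue; auto; lia|].
eapply Rle_lt_trans; [apply partial_conv_early; auto; lia|].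
destruct k; [lia | apply alpha_neg].
Qed.

Lemma partial_conv_le0 (u : nat -> R) (k n : nat) : root_coeff u -> root_conv u ->
  (n < k)%nat -> partial_conv u k n <= 0.
Proof.
intros Hu Hw Hk. pose proof (Nat.div_mod_eq n 3) as E.
pose proof (Nat.mod_upper_bound n 3 ltac:(lia)) as Hr.
set (m := (n / 3)%nat) in *. set (r := (n mod 3)%nat) in *. clearbody m r. subst n.
eapply Rle_trans; [apply partial_conv_residue; auto; lia|].
destruct (Nat.le_gt_cases (6 * m) (k + 1)) as [Hm | Hm].
- eapply Rle_trans; [apply partial_conv_early; auto; lia|].
  destruct k; [lia | apply Rlt_le, alpha_neg].
- pose proof (Nat.div_mod_eq (k - 1) 3) as E.
  pose proof (Nat.mod_upper_bound (k - 1) 3 ltac:(lia)) as Hr'.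
  (* The largest multiple of 3 strictly below [k] is 3 ((k - 1) / 3). *)
  apply (partial_conv_late u ((k - 1) / 3 - m)); auto; lia.
Qed.

(** By [root_coeff_3] each block at 3m+1, 3m+2, 3m+3 has positive sum, and the leftover terms are
    positive. *)
Lemma sum_root_coeff_pos (u : nat -> R) (n : nat) : root_coeff u -> 0 < sum_n u n.
Proof.
intros Hu.
assert (H3 : forall m, 0 < sum_n u (3 * m)).
{ induction m as [|m IH].
  - rewrite Nat.mul_0_r, sum_O. destruct Hu as (-> & _). lra.
  - pose proof (root_coeff_3 u m Hu) as E. pose proof (root_coeff_pos u m Hu) as (Pp & Pq & _).
    replace (3 * S m)%nat with (S (S (S (3 * m)))) by lia. rewrite !sum_Sn.
    replace (3 * m + 1)%nat with (S (3 * m)) in * by lia.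
    replace (3 * m + 2)%nat with (S (S (3 * m))) in * by lia.
    replace (3 * m + 3)%nat with (S (S (S (3 * m)))) in * by lia.
    change plus with Rplus. pose proof (pos_INR m). nra. }
pose proof (Nat.div_mod_eq n 3) as E.
pose proof (Nat.mod_upper_bound n 3 ltac:(lia)) as Hr.
set (m := (n / 3)%nat) in *. set (r := (n mod 3)%nat) in *. clearbody m r. subst n.
specialize (H3 m). pose proof (root_coeff_pos u m Hu) as (Pp & Pq & _).
assert (r = 0 \/ r = 1 \/ r = 2)%nat as [-> | [-> | ->]] by lia.
- now rewrite Nat.add_0_r.
- replace (3 * m + 1)%nat with (S (3 * m)) in * by lia. rewrite sum_Sn. change plus with Rplus. lra.
- replace (3 * m + 2)%nat with (S (S (3 * m))) in * by lia. rewrite !sum_Sn.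
  replace (3 * m + 1)%nat with (S (3 * m)) in * by lia. change plus with Rplus. lra.
Qed.

(** * Differential equations on the unit disk *)

Lemma CV_radius_ge_1 (a : nat -> R) :
  (forall x, Rabs x < 1 -> ex_pseries a x) -> Rbar_le 1 (CV_radius a).
Proof.
intros H. apply Rbar_not_lt_le. intros Hlt.
pose proof (CV_radius_ge_0 a) as H0.
destruct (CV_radius a) as [r | |] eqn:E; simpl in Hlt, H0; try contradiction.
(* A point between a radius r < 1 and 1: the terms would not tend to 0 there, although the series
   converges. *)
set (x := (r + 1) / 2).
assert (Hx : Rabs x = x) by (apply Rabs_pos_eq; unfold x; lra).
apply (CV_disk_outside a x).
- rewrite E, Hx. simpl. unfold x. lra.
- apply ex_series_lim_0. apply ex_pseries_R, H. rewrite Hx. unfold x. lra.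
Qed.

Lemma Rbar_lt_CV (a : nat -> R) (x : R) :
  Rbar_le 1 (CV_radius a) -> Rabs x < 1 -> Rbar_lt (Rabs x) (CV_radius a).
Proof. intros H Hx. apply Rbar_lt_le_trans with (2 := H). exact Hx. Qed.

Lemma locally_unit (x : R) (P : R -> Prop) :
  Rabs x < 1 -> (forall y, Rabs y < 1 -> P y) -> locally x P.
Proof.
intros Hx HP.
assert (Hd : 0 < 1 - Rabs x) by lra.
exists (mkposreal _ Hd). intros y Hy. apply HP.
change (Rabs (y - x) < 1 - Rabs x) in Hy.
pose proof (Rabs_triang x (y - x)) as T. rewrite Rplus_minus in T. lra.
Qed.

Lemma PSeries_ext_unit (a b : nat -> R) :
  Rbar_le 1 (CV_radius a) -> Rbar_le 1 (CV_radius b) ->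
  (forall x, Rabs x < 1 -> PSeries a x = PSeries b x) -> forall n, a n = b n.
Proof.
intros Ha Hb H n. apply PSeries_ext_recip.
- apply Rbar_lt_le_trans with (2 := Ha). simpl. lra.
- apply Rbar_lt_le_trans with (2 := Hb). simpl. lra.
- apply locally_unit; [rewrite Rabs_R0; lra | exact H].
Qed.

Lemma ex_pseries_unit (a : nat -> R) (x : R) :
  Rbar_le 1 (CV_radius a) -> Rabs x < 1 -> ex_pseries a x.
Proof. intros Ha Hx. apply CV_radius_inside. now apply Rbar_lt_CV. Qed.

Lemma CV_radius_plus_ge_1 (a b : nat -> R) :
  Rbar_le 1 (CV_radius a) -> Rbar_le 1 (CV_radius b) -> Rbar_le 1 (CV_radius (PS_plus a b)).
Proof.
intros Ha Hb. apply CV_radius_ge_1. intros x Hx.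
apply ex_pseries_plus; now apply ex_pseries_unit.
Qed.

Lemma CV_radius_scal_ge_1 (c : R) (a : nat -> R) :
  Rbar_le 1 (CV_radius a) -> Rbar_le 1 (CV_radius (PS_scal c a)).
Proof.
intros Ha. apply CV_radius_ge_1. intros x Hx.
apply ex_pseries_scal; [apply Rmult_comm | now apply ex_pseries_unit].
Qed.

Lemma CV_radius_incr_ge_1 (a : nat -> R) :
  Rbar_le 1 (CV_radius a) -> Rbar_le 1 (CV_radius (PS_incr_1 a)).
Proof.
intros Ha. apply CV_radius_ge_1. intros x Hx.
apply ex_pseries_incr_1. now apply ex_pseries_unit.
Qed.

Lemma CV_radius_derive_ge_1 (a : nat -> R) :
  Rbar_le 1 (CV_radius a) -> Rbar_le 1 (CV_radius (PS_derive a)).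
Proof. now rewrite CV_radius_derive. Qed.

Lemma CV_radius_mult_ge_1 (a b : nat -> R) :
  Rbar_le 1 (CV_radius a) -> Rbar_le 1 (CV_radius b) -> Rbar_le 1 (CV_radius (PS_mult a b)).
Proof.
intros Ha Hb. apply CV_radius_ge_1. intros x Hx.
apply ex_pseries_mult; now apply Rbar_lt_CV.
Qed.

#[local] Hint Resolve CV_radius_plus_ge_1 CV_radius_scal_ge_1 CV_radius_incr_ge_1 CV_radius_derive_ge_1 CV_radius_mult_ge_1 ex_pseries_unit : unit_disk.

(** The partial sums decrease, and the closed form [sum_alpha] keeps them positive. This gives
    convergence up to the boundary circle. *)
Lemma ex_series_alpha : ex_series alpha.
Proof.
destruct (ex_finite_lim_seq_decr (sum_n alpha) 0) as [l Hl].
- intros n. rewrite sum_Sn. change plus with Rplus. pose proof (alpha_neg n). lra.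
- intros n. rewrite sum_alpha. pose proof (alpha_neg n). pose proof (pos_INR n). nra.
- exists l. exact Hl.
Qed.

Lemma ex_series_Rabs_alpha : ex_series (fun k => Rabs (alpha k)).
Proof.
apply ex_series_incr_1.
apply ex_series_ext with (fun k => opp (alpha (S k))).
- intros k. rewrite Rabs_left; [reflexivity | apply alpha_neg].
- apply (ex_series_opp (V := R_NormedModule) (fun k => alpha (S k))). apply (ex_series_incr_1 alpha). exact ex_series_alpha.
Qed.

Lemma CV_radius_alpha_ge_1 : Rbar_le 1 (CV_radius alpha).
Proof.
apply CV_radius_ge_1. intros x Hx. apply ex_pseries_R.
apply (ex_series_le (K := R_AbsRing) (V := R_CompleteNormedModule)) with (2 := ex_series_Rabs_alpha).
intros n.
change (Rabs (alpha n * x ^ n) <= Rabs (alpha n)).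
rewrite Rabs_mult, <- RPow_abs.
pose proof (Rabs_pos (alpha n)). pose proof (Rabs_pos x).
assert (Rabs x ^ n <= 1) by (rewrite <- (pow1 n); apply pow_incr; lra). nra.
Qed.

Lemma alpha_ode (x : R) : Rabs x < 1 ->
  (1 - x) * PSeries (PS_derive alpha) x = - (1 / 2) * PSeries alpha x.
Proof.
intros Hx. pose proof CV_radius_alpha_ge_1 as Ha.
transitivity (PSeries (PS_plus (PS_derive alpha) (PS_scal (-1) (PS_incr_1 (PS_derive alpha)))) x).
- rewrite PSeries_plus, PSeries_scal, PSeries_incr_1 by auto 6 with unit_disk. ring.
- rewrite <- PSeries_scal. apply PSeries_ext. intros n.
  unfold PS_plus, PS_scal, PS_incr_1, PS_derive.
  change plus with Rplus; change scal with Rmult; change zero with 0.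
  pose proof (alpha_S n) as H. destruct n as [|n]; rewrite !S_INR in *; simpl (INR 0) in *; lra.
Qed.

Lemma root_ode (u : nat -> R) (x : R) :
  Rbar_le 1 (CV_radius u) ->
  (forall y, Rabs y < 1 -> PSeries u y ^ 2 = 1 + y + y ^ 2) ->
  Rabs x < 1 ->
  (1 + x + x ^ 2) * PSeries (PS_derive u) x = (1 / 2 + x) * PSeries u x.
Proof.
intros Hu Hsq Hx.
pose proof (is_derive_PSeries u x (Rbar_lt_CV u x Hu Hx)) as Hd.
assert (H1 : is_derive (fun y => PSeries u y ^ 2) x (2 * PSeries u x * PSeries (PS_derive u) x)).
{ evar_last. apply is_derive_pow. exact Hd. simpl. ring. }
assert (H2 : is_derive (fun y => PSeries u y ^ 2) x (1 + 2 * x)).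
{ apply is_derive_ext_loc with (fun y => 1 + y + y ^ 2).
  - apply locally_unit; [exact Hx | intros y Hy; symmetry; now apply Hsq].
  - auto_derive; [trivial | ring]. }
apply is_derive_unique in H1. apply is_derive_unique in H2. rewrite H1 in H2.
(* With 1 + x + x^2 written as U^2, the claim is U times the relation U U' = 1/2 + x. *)
rewrite <- Hsq by exact Hx. nra.
Qed.

Lemma root_coeff_of_square (u : nat -> R) :
  Rbar_le 1 (CV_radius u) -> u 0%nat = 1 ->
  (forall x, Rabs x < 1 -> PSeries u x ^ 2 = 1 + x + x ^ 2) ->
  root_coeff u.
Proof.
intros Hu H0 Hsq.
(* The coefficients of [root_ode], with [PS_incr_1] as multiplication by x. Index 0 gives [u 1], and
   index [S n] the recurrence. *)
assert (E : forall n, PS_plus (PS_derive u) (PS_plus (PS_incr_1 (PS_derive u)) (PS_incr_1 (PS_incr_1 (PS_derive u)))) n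
  = PS_plus (PS_scal (1 / 2) u) (PS_incr_1 u) n).
{ apply PSeries_ext_unit; [auto 8 with unit_disk .. |].
  intros x Hx.
  rewrite !PSeries_plus, PSeries_scal, !PSeries_incr_1 by auto 8 with unit_disk.
  pose proof (root_ode u x Hu Hsq Hx). lra. }
split; [exact H0 | split].
- specialize (E 0%nat). unfold PS_plus, PS_scal, PS_incr_1, PS_derive in E.
  change plus with Rplus in E; change scal with Rmult in E; change zero with 0 in E. simpl in E. lra.
- intros n. specialize (E (S n)). unfold PS_plus, PS_scal, PS_incr_1, PS_derive in E.
  change plus with Rplus in E; change scal with Rmult in E; change zero with 0 in E.
  rewrite !S_INR in *. destruct n; rewrite ?S_INR in *; simpl in *; lra.
Qed.

Lemma root_conv_of_square (u : nat -> R) :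
  Rbar_le 1 (CV_radius u) -> u 0%nat = 1 ->
  (forall x, Rabs x < 1 -> PSeries u x ^ 2 = 1 + x + x ^ 2) ->
  root_conv u.
Proof.
intros Hu H0 Hsq. pose proof CV_radius_alpha_ge_1 as Ha.
set (w := PS_mult u alpha).
assert (Hw : Rbar_le 1 (CV_radius w)) by (unfold w; auto with unit_disk).
assert (Ew : forall k, w k = partial_conv u k k).
{ intros k. unfold w, PS_mult, partial_conv. now rewrite sum_n_Reals. }
assert (Hode : forall x, Rabs x < 1 ->
  (1 - x ^ 3) * PSeries (PS_derive w) x = - (3 / 2) * x ^ 2 * PSeries w x).
{ intros x Hx.
  pose proof (is_derive_PSeries u x (Rbar_lt_CV u x Hu Hx)) as Du.
  pose proof (is_derive_PSeries alpha x (Rbar_lt_CV alpha x Ha Hx)) as Da.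
  pose proof (is_derive_PSeries w x (Rbar_lt_CV w x Hw Hx)) as Dw.
  assert (Dw' : is_derive (PSeries w) x
    (PSeries (PS_derive u) x * PSeries alpha x + PSeries u x * PSeries (PS_derive alpha) x)).
  { apply is_derive_ext_loc with (fun y => PSeries u y * PSeries alpha y).
    - apply locally_unit; [exact Hx |]. intros y Hy. symmetry.
      apply PSeries_mult; now apply Rbar_lt_CV.
    - apply (is_derive_mult (PSeries u) (PSeries alpha) x _ _ Du Da). apply Rmult_comm. }
  apply is_derive_unique in Dw. apply is_derive_unique in Dw'. rewrite Dw in Dw'. rewrite Dw'.
  unfold w. rewrite PSeries_mult by now apply Rbar_lt_CV.
  pose proof (root_ode u x Hu Hsq Hx) as Ou. pose proof (alpha_ode x Hx) as Oa.
  set (U := PSeries u x) in *. set (U' := PSeries (PS_derive u) x) in *.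
  set (A := PSeries alpha x) in *. set (A' := PSeries (PS_derive alpha) x) in *.
  (* The factorization 1 - x^3 = (1 - x) (1 + x + x^2) splits the product rule into the two known
     equations. *)
  transitivity ((1 - x) * A * ((1 + x + x ^ 2) * U') + (1 + x + x ^ 2) * U * ((1 - x) * A')).
  - ring.
  - rewrite Ou, Oa. field. }
set (D := PS_derive w).
assert (HD : Rbar_le 1 (CV_radius D)) by (unfold D; auto with unit_disk).
assert (E : forall n, PS_plus D (PS_scal (-1) (PS_incr_1 (PS_incr_1 (PS_incr_1 D)))) n
  = PS_scal (- (3 / 2)) (PS_incr_1 (PS_incr_1 w)) n).
{ apply PSeries_ext_unit; [auto 8 with unit_disk .. |].
  intros x Hx.
  rewrite PSeries_plus, !PSeries_scal, !PSeries_incr_1 by auto 8 with unit_disk.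
  pose proof (Hode x Hx) as O. fold D in O. lra. }
unfold PS_plus, PS_scal, PS_incr_1, D, PS_derive in E.
change plus with Rplus in E; change scal with Rmult in E; change zero with 0 in E.
assert (W0 : w 0%nat = 1).
{ rewrite Ew. unfold partial_conv. rewrite sum_O, H0. simpl. ring. }
(* The right side x^2 w of [E] has no terms of degree 0 and 1. *)
assert (W1 : w 1%nat = 0) by (specialize (E 0%nat); simpl in E; lra).
assert (W2 : w 2%nat = 0) by (specialize (E 1%nat); simpl in E; lra).
assert (W3 : forall k, (INR k + 3) * w (S (S (S k))) = (INR k - 3 / 2) * w k).
{ intros k. specialize (E (S (S k))). rewrite !S_INR in *.
  destruct k; rewrite ?S_INR in *; simpl in *; lra. }
intros m. rewrite <- !Ew. now apply cubic_coeff.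
Qed.

(** * Complex series and the zeros of the partial sums *)

Open Scope C_scope.

Lemma is_series_Re (a : nat -> C) (l : C) :
  is_series (K := C_AbsRing) (V := C_NormedModule) a l ->
  is_series (fun k => Re (a k)) (Re l).
Proof.
intros H. unfold is_series in *.
apply filterlim_ext with (fun n => fst (sum_n (G := C_AbelianMonoid) a n)).
- intros n. induction n as [|n IH].
  + now rewrite !sum_O.
  + rewrite !sum_Sn, <- IH. reflexivity.
- eapply filterlim_comp; [exact H |]. destruct l as [x y]. apply (continuous_fst x y).
Qed.

Lemma is_series_Im (a : nat -> C) (l : C) :
  is_series (K := C_AbsRing) (V := C_NormedModule) a l ->
  is_series (fun k => Im (a k)) (Im l).
Proof.
intros H. unfold is_series in *.
apply filterlim_ext with (fun n => snd (sum_n (G := C_AbelianMonoid) a n)).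
- intros n. induction n as [|n IH].
  + now rewrite !sum_O.
  + rewrite !sum_Sn, <- IH. reflexivity.
- eapply filterlim_comp; [exact H |]. destruct l as [x y]. apply (continuous_snd x y).
Qed.

Lemma Re_mult_R (c : C) (r : R) : Re (c * RtoC r) = (Re c * r)%R.
Proof. destruct c as [x y]. unfold Re, Cmult, RtoC. simpl. ring. Qed.

Lemma Im_mult_R (c : C) (r : R) : Im (c * RtoC r) = (Im c * r)%R.
Proof. destruct c as [x y]. unfold Im, Cmult, RtoC. simpl. ring. Qed.

(** On (-1, 1) the square of f is the positive number 1 + x + x^2, so f is real there. The series of
    imaginary parts then vanishes, and that of real parts squares to 1 + x + x^2. *)
Lemma taylor_real (f : C -> C) (b : nat -> C) :
  is_sqrt_branch f -> is_taylor_expansion_on_unit_disk f b ->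
  exists u : nat -> R, root_coeff u /\ root_conv u /\ forall k, b k = RtoC (u k).
Proof.
intros (_ & Hsq & Hf0) Hb.
set (u := fun k => Re (b k)). set (v := fun k => Im (b k)).
assert (Hc : forall x : R, (Rabs x < 1)%R -> (Cmod (RtoC x) < 1)%R).
{ intros x Hx. now rewrite Cmod_R. }
assert (Su : forall x : R, (Rabs x < 1)%R -> is_pseries u x (Re (f (RtoC x)))).
{ intros x Hx. apply is_pseries_R.
  eapply is_series_ext; [| exact (is_series_Re _ _ (Hb (RtoC x) (Hc x Hx)))].
  intros k. cbv beta. now rewrite <- RtoC_pow, Re_mult_R. }
assert (Sv : forall x : R, (Rabs x < 1)%R -> is_pseries v x (Im (f (RtoC x)))).
{ intros x Hx. apply is_pseries_R.
  eapply is_series_ext; [| exact (is_series_Im _ _ (Hb (RtoC x) (Hc x Hx)))].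
  intros k. cbv beta. now rewrite <- RtoC_pow, Im_mult_R. }
assert (Cu : Rbar_le 1%R (CV_radius u)).
{ apply CV_radius_ge_1. intros x Hx. eexists. now apply Su. }
assert (Cv : Rbar_le 1%R (CV_radius v)).
{ apply CV_radius_ge_1. intros x Hx. eexists. now apply Sv. }
assert (Hre : forall x : R, (Rabs x < 1)%R ->
  (Re (f (RtoC x)) ^ 2 - Im (f (RtoC x)) ^ 2 = 1 + x + x ^ 2)%R /\
  (Re (f (RtoC x)) * Im (f (RtoC x)) = 0)%R).
{ intros x Hx. pose proof (Hsq (RtoC x) (Hc x Hx)) as E.
  destruct (f (RtoC x)) as [s t]. simpl. injection E as E1 E2. simpl in E1, E2. lra. }
assert (Him : forall x : R, (Rabs x < 1)%R -> Im (f (RtoC x)) = 0%R).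
{ intros x Hx. destruct (Hre x Hx) as [E1 E2]. apply Rmult_integral in E2.
  destruct E2 as [E2 | E2]; [| exact E2]. rewrite E2 in E1. nra. }
assert (Hv : forall k, v k = 0%R).
{ apply PSeries_ext_unit with (b := fun _ => 0%R); [exact Cv | |].
  - rewrite CV_radius_const_0. exact I.
  - intros x Hx. rewrite PSeries_const_0, <- (Him x Hx). apply is_pseries_unique. now apply Sv. }
assert (Hsqu : forall x : R, (Rabs x < 1)%R -> (PSeries u x ^ 2 = 1 + x + x ^ 2)%R).
{ intros x Hx. rewrite (is_pseries_unique _ _ _ (Su x Hx)).
  destruct (Hre x Hx) as [E1 _]. rewrite (Him x Hx) in E1. lra. }
assert (Hu0 : u 0%nat = 1%R).
{ rewrite <- (PSeries_0 u).
  rewrite (is_pseries_unique _ _ _ (Su 0%R ltac:(rewrite Rabs_R0; lra))). now rewrite Hf0. }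
exists u. split; [| split].
- now apply root_coeff_of_square.
- now apply root_conv_of_square.
- intros k. specialize (Hv k). unfold u, v in *. destruct (b k) as [s t]. simpl in *. now subst t.
Qed.

Lemma ex_series_alpha_pow (z : C) : (Cmod z <= 1)%R ->
  ex_series (K := C_AbsRing) (V := C_NormedModule) (fun k => RtoC (alpha k) * z ^ k).
Proof.
intros Hz.
apply (ex_series_le (K := C_AbsRing) (V := C_CompleteNormedModule)) with (2 := ex_series_Rabs_alpha).
intros n. change (Cmod (RtoC (alpha n) * z ^ n) <= Rabs (alpha n))%R.
rewrite Cmod_mult, Cmod_R, Cmod_pow.
pose proof (Rabs_pos (alpha n)). pose proof (Cmod_ge_0 z).
assert (Cmod z ^ n <= 1)%R by (rewrite <- (pow1 n); apply pow_incr; lra). nra.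
Qed.

(* Coefficients of the product of the [n]-th partial sum with [sqrt (1 - z)];
   the minimum discards the indices where [k - j] would be truncated. *)
Definition product_coeff (u : nat -> R) (n k : nat) : R := partial_conv u k (Nat.min n k).

Lemma product_coeff_S (u : nat -> R) (n k : nat) :
  product_coeff u (S n) k =
  (product_coeff u n k + u (S n) * (if Compare_dec.le_lt_dec (S n) k then alpha (k - S n) else 0))%R.
Proof.
unfold product_coeff. destruct (Compare_dec.le_lt_dec (S n) k) as [H | H].
- rewrite !Nat.min_l by lia. apply partial_conv_S.
- rewrite !Nat.min_r by lia. ring.
Qed.

Lemma is_series_shift (a : nat -> C) (z l : C) (d : nat) :
  is_series (K := C_AbsRing) (V := C_NormedModule) (fun k => a k * z ^ k) l ->
  is_series (K := C_AbsRing) (V := C_NormedModule)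
    (fun k => (if Compare_dec.le_lt_dec d k then a (k - d)%nat else 0) * z ^ k) (z ^ d * l).
Proof.
assert (Epow : forall k, pow_n (K := C_AbsRing) z k = z ^ k).
{ induction k as [|k IH]; [reflexivity | simpl; now rewrite IH]. }
intros H.
pose proof (is_pseries_incr_n (K := C_AbsRing) (V := C_NormedModule) a d z l) as P.
rewrite Epow in P. eapply is_series_ext; [| apply P].
- intros k. cbv beta. rewrite PS_incr_n_simplify, Epow. apply Cmult_comm.
- eapply is_series_ext; [| exact H]. intros k. cbv beta. exact (Cmult_comm _ _).
Qed.

(** One factor is a polynomial, so induction on [n] works wherever the [alpha] series converges:
    each new term adds a shifted, scaled copy of that series. *)
Lemma is_series_product (u : nat -> R) (b : nat -> C) (z l : C) (n : nat) :
  (forall k, b k = RtoC (u k)) ->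
  is_series (K := C_AbsRing) (V := C_NormedModule) (fun k => RtoC (alpha k) * z ^ k) l ->
  is_series (K := C_AbsRing) (V := C_NormedModule)
    (fun k => RtoC (product_coeff u n k) * z ^ k) (partial_sum b n z * l).
Proof.
intros Hb Hl. induction n as [|n IH].
- unfold partial_sum. rewrite sum_O, Hb.
  replace (RtoC (u 0%nat) * z ^ 0 * l) with (RtoC (u 0%nat) * l) by (simpl; ring).
  eapply is_series_ext;
    [| exact (is_series_scal (K := C_AbsRing) (V := C_NormedModule) (RtoC (u 0%nat)) _ _ Hl)].
  intros k. change (RtoC (u 0%nat) * (RtoC (alpha k) * z ^ k) = RtoC (product_coeff u 0 k) * z ^ k).
  unfold product_coeff, partial_conv. rewrite Nat.min_0_l, sum_O, Nat.sub_0_r, RtoC_mult. ring.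
- pose proof (is_series_shift (fun k => RtoC (alpha k)) z l (S n) Hl) as Hs.
  apply (is_series_scal (K := C_AbsRing) (V := C_NormedModule) (RtoC (u (S n)))) in Hs.
  pose proof (is_series_plus (K := C_AbsRing) (V := C_NormedModule) _ _ _ _ IH Hs) as P.
  replace (partial_sum b (S n) z * l)
    with (partial_sum b n z * l + RtoC (u (S n)) * (z ^ S n * l)).
  2: { unfold partial_sum. rewrite sum_Sn, Hb.
       change (@plus C_AbelianMonoid) with Cplus. ring. }
  eapply is_series_ext; [| exact P]. intros k. cbv beta.
  change (@plus (NormedModule.AbelianMonoid C_AbsRing C_NormedModule)) with Cplus.
  change (@scal C_AbsRing C_NormedModule) with Cmult.
  rewrite product_coeff_S, RtoC_plus, RtoC_mult.
  destruct (Compare_dec.le_lt_dec (S n) k); match goal with |- ?x = ?y => change (@eq C x y) end; ring.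
Qed.

Lemma product_coeff_le0 (u : nat -> R) (n k : nat) : root_coeff u -> root_conv u ->
  (product_coeff u n (S k) <= 0)%R.
Proof.
intros Hu Hw. unfold product_coeff.
destruct (Nat.le_gt_cases (S k) n) as [H | H].
- rewrite Nat.min_r by exact H.
  pose proof (Nat.div_mod_eq (S k) 3) as E.
  pose proof (Nat.mod_upper_bound (S k) 3 ltac:(lia)) as Hr.
  set (m := (S k / 3)%nat) in *. set (r := (S k mod 3)%nat) in *. clearbody m r. rewrite E.
  destruct (Hw m) as (W0 & W1 & W2).
  assert (r = 0 \/ r = 1 \/ r = 2)%nat as [-> | [-> | ->]] by lia.
  + rewrite Nat.add_0_r, W0. destruct m; [lia | apply Rlt_le, alpha_neg].
  + rewrite W1. apply Rle_refl.
  + rewrite W2. apply Rle_refl.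
- rewrite Nat.min_l by lia. now apply partial_conv_le0.
Qed.

(** The partial sums decrease to [l], so 0 <= l <= [sum_n a k + a (S k)] <= [a (S k)]. *)
Lemma is_series_nonpos_eq0 (a : nat -> R) (l : R) :
  (forall k, a k <= 0)%R -> (0 <= l)%R -> is_series a l -> forall k, a k = 0%R.
Proof.
intros Ha Hl Hs k. apply Rle_antisym; [apply Ha |].
assert (Hdecr : forall n, (sum_n a (S n) <= sum_n a n)%R).
{ intros n. rewrite sum_Sn. change (@plus R_AbelianMonoid) with Rplus. pose proof (Ha (S n)). lra. }
pose proof (is_lim_seq_decr_compare _ _ Hs Hdecr k) as Hk.
assert (Hneg : forall n, (sum_n a n <= 0)%R).
{ induction n as [|n IH]; [rewrite sum_O; apply Ha | eapply Rle_trans; [apply Hdecr | exact IH]]. }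
destruct k as [|k].
- rewrite sum_O in Hk. lra.
- rewrite sum_Sn in Hk. change (l <= sum_n a k + a (S k))%R in Hk. specialize (Hneg k). lra.
Qed.

Lemma Re_eq_1 (w : C) : (Cmod w <= 1)%R -> Re w = 1%R -> w = 1.
Proof.
destruct w as [x y]. unfold Cmod. simpl. intros H ->.
assert (Hs : (1 * (1 * 1) + y * (y * 1) <= 1)%R).
{ apply sqrt_le_0; [nra | lra |]. rewrite sqrt_1. exact H. }
assert (y = 0)%R as -> by nra. reflexivity.
Qed.

Lemma partial_sum_1 (u : nat -> R) (b : nat -> C) (n : nat) :
  (forall k, b k = RtoC (u k)) -> partial_sum b n 1 = RtoC (sum_n u n).
Proof.
intros Hb. unfold partial_sum. induction n as [|n IH].
- rewrite !sum_O, Hb. simpl. ring.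
- rewrite !sum_Sn, IH, Hb.
  change (@plus C_AbelianMonoid) with Cplus. change (@plus R_AbelianMonoid) with Rplus.
  rewrite RtoC_plus, <- RtoC_pow, pow1. ring.
Qed.

Lemma sum_alpha_nonneg (l : R) : is_series alpha l -> (0 <= l)%R.
Proof.
intros H.
apply (is_lim_seq_le (fun _ => 0%R) (sum_n alpha) (Finite 0) (Finite l));
  [| apply is_lim_seq_const | exact H].
intros n. rewrite sum_alpha. pose proof (alpha_neg n). pose proof (pos_INR n). nra.
Qed.

Theorem theorem1p1 :
  forall (f : C -> C) (b : nat -> C),
    is_sqrt_branch f ->
    is_taylor_expansion_on_unit_disk f b ->
    forall (n : nat) (z : C), (Cmod z <= 1)%R -> partial_sum b n z <> 0.
Proof.
intros f b Hf Hb n z Hz Hzero.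
destruct (taylor_real f b Hf Hb) as (u & Hu & Hw & Hbu).
pose proof (sum_root_coeff_pos u n Hu) as Hpos.
set (h := product_coeff u n).
(* The sum at z = 1 is s_n(1) times the sum of [alpha]; the first is positive, the second a limit of
   positive partial sums. *)
assert (H1 : exists s, (0 <= s)%R /\ is_series h s).
{ destruct (ex_series_alpha_pow 1) as [l Hl]; [rewrite Cmod_1; lra |].
  pose proof (is_series_Re _ _ (is_series_product u b 1 l n Hbu Hl)) as S1.
  exists (sum_n u n * Re l)%R. split.
  - apply Rmult_le_pos; [lra |]. apply sum_alpha_nonneg.
    eapply is_series_ext; [| exact (is_series_Re _ _ Hl)].
    intros k. cbv beta. rewrite <- RtoC_pow, pow1, Cmult_1_r. reflexivity.
  - replace (sum_n u n * Re l)%R with (Re (partial_sum b n 1 * l)).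
    + eapply is_series_ext; [| exact S1].
      intros k. cbv beta. rewrite <- RtoC_pow, pow1, Cmult_1_r. reflexivity.
    + rewrite (partial_sum_1 u b n Hbu), Cmult_comm, Re_mult_R. apply Rmult_comm. }
destruct H1 as (s & Hs0 & Hs).
destruct (ex_series_alpha_pow z Hz) as [l Hl].
pose proof (is_series_Re _ _ (is_series_product u b z l n Hbu Hl)) as Sz.
rewrite Hzero, Cmult_0_l in Sz.
assert (Hre : forall k, (Re (z ^ k) <= 1)%R).
{ intros k. pose proof (re_le_Cmod (z ^ k)) as B. rewrite Cmod_pow in B.
  pose proof (Cmod_ge_0 z). pose proof (Rle_abs (Re (z ^ k))).
  assert (Cmod z ^ k <= 1)%R by (rewrite <- (pow1 k); apply pow_incr; lra). lra. }
(* The real part of the series at the zero [z], whose sum is 0, is subtracted from the series at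
   1. *)
assert (Hdiff : is_series (fun k => h k * (1 - Re (z ^ k)))%R s).
{ replace s with (plus s (opp (Re 0))) by (change (s + - 0 = s)%R; ring).
  eapply is_series_ext; [| exact (is_series_minus _ _ _ _ Hs Sz)].
  intros k. change (h k + - Re (RtoC (h k) * z ^ k) = h k * (1 - Re (z ^ k)))%R.
  rewrite (Cmult_comm (RtoC (h k))), Re_mult_R. ring. }
assert (Hall : forall k, (h k * (1 - Re (z ^ k)) = 0)%R).
{ apply is_series_nonpos_eq0 with (2 := Hs0) (3 := Hdiff). intros [|k].
  (* The only positive coefficient, at k = 0, meets the factor 1 - Re z^0 = 0. *)
  - simpl. lra.
  - pose proof (product_coeff_le0 u n k Hu Hw) as Hk. fold h in Hk.
    pose proof (Hre (S k)). nra. }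
assert (Hone : forall k, (2 * n < k)%nat -> z ^ k = 1).
{ intros k Hk. apply Re_eq_1.
  - rewrite Cmod_pow. pose proof (Cmod_ge_0 z). rewrite <- (pow1 k). apply pow_incr. lra.
  - pose proof (partial_conv_neg u k n Hu Hk) as Hn.
    specialize (Hall k). unfold h, product_coeff in Hall. rewrite Nat.min_l in Hall by lia.
    apply Rmult_integral in Hall. lra. }
assert (z = 1) as ->.
{ pose proof (Hone (S (2 * n)) ltac:(lia)) as E1.
  pose proof (Hone (S (S (2 * n))) ltac:(lia)) as E2.
  change (z * z ^ S (2 * n) = 1) in E2. rewrite E1, Cmult_1_r in E2. exact E2. }
rewrite (partial_sum_1 u b n Hbu) in Hzero. apply RtoC_inj in Hzero. lra.
Qed.
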